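(* Let $q$ be a prime power with $q-1=ml^2$ for integers $l,m\ge 2$. Let $\theta$ be a primitive element of $\mathbb{F}_q$, put $\beta=\theta^l$ and $C=\langle\beta^m\rangle=\langle\theta^{ml}\rangle\le\mathbb{F}_q^*$. Let $\sigma:\mathbb{Z}_m\to\mathbb{Z}_{ml}$ be an injective map, where elements of $\mathbb{Z}_{ml}$ are identified with their representatives in $\{0,\dots,ml-1\}$, and put $D_j=\theta^{\sigma(j)}C$ for $0\le j\le m-1$. Then for any non-empty subset $S\subseteq\{1,\dots,m-1\}$, the family $\{D_0,\dots,D_{m-1}\}$ is a $(q,m,l;|S|)$-$S$-CEDF in $(\mathbb{F}_q,+)$ if and only if every coset of $C$ in $\mathbb{F}_q^*$ contains exactly $|S|$ elements (counted with multiplicity) of the multiset $$\{\{\theta^{\sigma(j+c)}-\theta^{\sigma(j)}\beta^{mr}:\ 0\le j\le m-1,\ 0\le r\le l-1,\ c\in S\}\},$$ where $j+c$ is taken modulo $m$.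
   Context: Let $(G,+)$ be a finite abelian group of order $n$ (written additively), let $l,m\ge 2$, and let $S$ be a non-empty subset of $\{1,\dots,m-1\}$. For non-empty subsets $A,B\subseteq G$, $\Delta(A,B)$ denotes the multiset $\{\{a-b: a\in A, b\in B\}\}$. A family $\{A_0,\dots,A_{m-1}\}$ of $m$ pairwise disjoint subsets of $G$ is an $(n,m,l;\lambda)$-$S$-circular external difference family (CEDF) in $G$ if $|A_i|=l$ for all $i$ and each nonzero $g\in G$ occurs exactly $\lambda$ times in the multiset union $\bigcup_{c\in S}\bigcup_{i=0}^{m-1}\Delta(A_{i+c},A_i)$, where subscripts are taken modulo $m$. *)

(* Defs.v *)
From HB Require Import structures.
From mathcomp Require Import all_boot all_order all_fingroup all_algebra.
From mathcomp Require Import all_solvable all_field.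

Set Implicit Arguments.
Unset Strict Implicit.
Unset Printing Implicit Defensive.

Import GRing.Theory.
Local Open Scope ring_scope.

(* Finite multisets are represented by sequences: the multiplicity of g in s  *)
(* is count_mem g s, and multiset union is concatenation.                     *)

Definition Delta (G : finZmodType) (A B : {set G}) : seq G :=
  [seq a - b | a <- enum A, b <- enum B].

Definition circular_differences (G : finZmodType) (m : nat)
    (S : {set 'Z_m}) (A : 'Z_m -> {set G}) : seq G :=
  \big[cat/[::]]_(c in S) \big[cat/[::]]_(i : 'Z_m) Delta (A (i + c)) (A i).

(* 'Z_m is the ring of integers modulo m only for m > 1, which is part of the *)
(* definition. A subset of {1, ..., m - 1} is a set of nonzero classes.       *)
Record is_CEDF (G : finZmodType) (n m l lambda : nat)
    (S : {set 'Z_m}) (A : 'Z_m -> {set G}) : Prop := IsCEDF {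
  CEDF_order : #|G| = n;
  CEDF_m_ge2 : (2 <= m)%N;
  CEDF_l_ge2 : (2 <= l)%N;
  CEDF_S_nonempty : S != set0;
  CEDF_S_nonzero : 0 \notin S;
  CEDF_disjoint : forall i j : 'Z_m, i != j -> [disjoint A i & A j];
  CEDF_card : forall i : 'Z_m, #|A i| = l;
  CEDF_count : forall g : G, g != 0 ->
    count_mem g (circular_differences S A) = lambda
}.

Section Cyclotomic.

Variables (F : finFieldType) (m l : nat) (theta : {unit F}).

(* The subset of F underlying a set of elements of its multiplicative group.  *)
Definition unit_carrier (X : {set {unit F}}) : {set F} :=
  [set val x | x in X].

Definition beta : {unit F} := (theta ^+ l)%g.

Definition subgroupC : {group {unit F}} := <[beta ^+ m]>%G.

Definition familyD (sigma : 'Z_m -> 'Z_(m * l)) (j : 'Z_m) : {set F} :=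
  unit_carrier ((theta ^+ sigma j)%g *: subgroupC)%g.

Definition shifted_differences (sigma : 'Z_m -> 'Z_(m * l))
    (S : {set 'Z_m}) : seq F :=
  \big[cat/[::]]_(c in S) \big[cat/[::]]_(j : 'Z_m)
    [seq val theta ^+ sigma (j + c)
         - val theta ^+ sigma j * val beta ^+ (m * r) | r : 'I_l].

End Cyclotomic.

(* Main.v *)
(* Dividing a x - b y = g by a, for a, b in the subgroup C of F^*, turns it   *)
(* into x - c y in g C, where c = b / a runs over C. So g occurs among the    *)
(* differences of x C and y C as often as x - y C meets g C, a number which   *)
(* depends only on the coset of g. This holds for every subgroup C; cyclicity *)
(* serves only to enumerate C and to separate the cosets theta^i C.           *)

Require Import Defs.
From HB Require Import structures.
From mathcomp Require Import all_boot all_order all_fingroup all_algebra.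
From mathcomp Require Import all_solvable all_field.

Set Implicit Arguments.
Unset Strict Implicit.
Unset Printing Implicit Defensive.

Import GRing.Theory.
Local Open Scope ring_scope.

Lemma count_bigcat (T I : Type) (a : pred T) (r : seq I) (P : pred I)
    (f : I -> seq T) :
  count a (\big[cat/[::]]_(i <- r | P i) f i)
    = (\sum_(i <- r | P i) count a (f i))%N.
Proof. exact: (big_morph (count a) (count_cat a)). Qed.

Lemma count_map_enum (I : finType) (T : Type) (a : pred T) (A : {set I})
    (f : I -> T) :
  count a [seq f i | i <- enum A] = (\sum_(i in A) a (f i))%N.
Proof. by rewrite -sum1_count big_map big_mkcond big_enum. Qed.

Lemma sum_eq_imset (I T : finType) (f : I -> T) (A : {set I}) (y : T) :
  {in A &, injective f} -> (\sum_(i in A) (y == f i) = (y \in f @: A))%N.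
Proof.
move=> f_inj; rewrite -(big_imset (fun z => nat_of_bool (y == z)) f_inj) /=.
case: (boolP (y \in _)) => [Ay | notAy].
  rewrite (bigD1 y) //= eqxx big1 // => z /andP[_ /negbTE].
  by rewrite eq_sym => ->.
rewrite big1 // => z Az; apply/eqP; rewrite eqb0.
by apply: contraNneq notAy => ->.
Qed.

Lemma count_Delta (G : finZmodType) (a : pred G) (A B : {set G}) :
  count a (Delta A B) = (\sum_(x in A) \sum_(y in B) a (x - y)%R)%N.
Proof.
rewrite /Delta count_flatten sumnE !big_map big_enum.
by apply: eq_bigr => x _; rewrite count_map_enum.
Qed.

Section PowersAndCycles.

Variable gT : finGroupType.
Implicit Type x : gT.

Lemma perm_enum_cycle x :
  perm_eq (enum <[x]>%g) [seq (x ^+ i)%g | i : 'I_#[x]%g].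
Proof.
apply: uniq_perm; first exact: enum_uniq.
  rewrite map_inj_uniq ?enum_uniq // => i j /eqP.
  by rewrite eq_expg_ord // => /eqP.
move=> y; rewrite mem_enum.
apply/idP/mapP => [/cyclePmin[i lt_i ->] | [i _ ->]].
  by exists (Ordinal lt_i); rewrite ?mem_enum.
exact: mem_cycle.
Qed.

Lemma expg_mem_cycle_expg x (k i : nat) :
  (k %| #[x]%g)%N -> ((x ^+ i)%g \in <[x ^+ k]>%g) = (k %| i)%N.
Proof.
move=> k_dvd; apply/cycleP/idP => [[r] /eqP | /dvdnP[r ->]].
  rewrite -expgM eq_expg_mod_order => /eqP /(congr1 (dvdn k)).
  by rewrite /dvdn !modn_dvdm // modnMr => ->.
by exists r; rewrite -expgM mulnC.
Qed.

Lemma lcoset_expg_cycle_expg x (k i j : nat) : (k %| #[x]%g)%N ->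
  ((x ^+ i *: <[x ^+ k]>)%g == (x ^+ j *: <[x ^+ k]>)%g) = (i == j %[mod k]).
Proof.
move=> k_dvd; wlog le_ij : i j / (i <= j)%N => [sym_ij | ].
  by case/orP: (leq_total i j) => /sym_ij // eq_ji; rewrite eq_sym eq_ji eq_sym.
rewrite eq_sym (sameP eqP lcoset_eqP) mem_lcoset -expgVn.
rewrite -(subnK le_ij) addnC expgD expgVn mulKg expg_mem_cycle_expg //.
by rewrite [RHS]eq_sym eqn_mod_dvd ?leq_addr // addKn.
Qed.

End PowersAndCycles.

Section CosetFamilies.

Variables (F : finFieldType) (C : {group {unit F}}).
Implicit Types x y g : {unit F}.

Definition coset_differences x y : seq F :=
  [seq val x - val y * val b | b <- enum C].

Definition circular_coset_differences (m : nat) (S : {set 'Z_m})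
    (x : 'Z_m -> {unit F}) : seq F :=
  \big[cat/[::]]_(c in S) \big[cat/[::]]_(i : 'Z_m)
    coset_differences (x (i + c)) (x i).

Lemma sum_unit_carrier_lcoset x (f : F -> nat) :
  (\sum_(z in unit_carrier (x *: C)%g) f z
    = \sum_(a in C) f (val x * val a)%R)%N.
Proof.
rewrite big_imset /=; last by move=> a b _ _; apply: val_inj.
by rewrite -lcosetE big_imset //= => a b _ _; apply: mulgI.
Qed.

Lemma sum_mul_eq_unit_carrier_lcoset g (z : F) :
  (\sum_(a in C) (z * val a == val g)%R)%N = (z \in unit_carrier (g *: C)%g).
Proof.
rewrite /unit_carrier -lcosetE /lcoset -imset_comp.
rewrite -sum_eq_imset; last by move=> a b _ _ /val_inj /mulgI.
rewrite [RHS](reindex_inj invg_inj) /=; apply: eq_big => a.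
  by rewrite groupV.
by move=> _; rewrite (can2_eq (mulrK (valP a)) (mulrVK (valP a))).
Qed.

Lemma count_Delta_lcosets x y g :
  count_mem (val g) (Delta (unit_carrier (x *: C)%g) (unit_carrier (y *: C)%g))
    = count [in unit_carrier (g *: C)%g] (coset_differences x y).
Proof.
rewrite count_Delta sum_unit_carrier_lcoset count_map_enum.
transitivity
  (\sum_(a in C) \sum_(c in C) ((val x - val y * val c) * val a == val g)%R)%N.
  apply: eq_bigr => a Ca.
  rewrite sum_unit_carrier_lcoset (reindex_inj (mulgI a)) /=.
  apply: eq_big => c; first by rewrite groupMl.
  by rewrite mulrBl -mulrA [val c * _]mulrC.
rewrite exchange_big; apply: eq_bigr => c _.
exact: sum_mul_eq_unit_carrier_lcoset.
Qed.

Lemma count_circular_differences_lcosets (m : nat) (S : {set 'Z_m})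
    (x : 'Z_m -> {unit F}) g :
  count_mem (val g)
      (circular_differences S (fun i => unit_carrier (x i *: C)%g))
    = count [in unit_carrier (g *: C)%g] (circular_coset_differences S x).
Proof.
rewrite !count_bigcat; apply: eq_bigr => c _.
by rewrite !count_bigcat; apply: eq_bigr => i _; apply: count_Delta_lcosets.
Qed.

Lemma disjoint_unit_carrier_lcosets x y :
  (x *: C)%g != (y *: C)%g ->
  [disjoint unit_carrier (x *: C)%g & unit_carrier (y *: C)%g].
Proof.
rewrite (imset_disjoint val_inj); apply: contraNT => /pred0Pn[z /andP[xz yz]].
by rewrite -(lcoset_eqP xz) -(lcoset_eqP yz).
Qed.

Lemma card_unit_carrier_lcoset x : #|unit_carrier (x *: C)%g| = #|C|.
Proof. by rewrite (card_imset _ val_inj) card_lcoset. Qed.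

Lemma is_CEDF_lcosets (m lambda : nat) (S : {set 'Z_m})
    (x : 'Z_m -> {unit F}) :
    (1 < m)%N -> (1 < #|C|)%N -> S != set0 -> 0 \notin S ->
    injective (fun i => x i *: C)%g ->
  is_CEDF #|F| #|C| lambda S (fun i => unit_carrier (x i *: C)%g)
  <->
  (forall X : {set {unit F}}, X \in lcosets C [set: {unit F}] ->
     count [in unit_carrier X] (circular_coset_differences S x) = lambda).
Proof.
move=> m_gt1 C_gt1 S_neq0 S'0 xC_inj.
split=> [cedf X /lcosetsP[g _ ->] | count_coset].
  rewrite -count_circular_differences_lcosets (CEDF_count cedf) //.
  by rewrite -unitfE (valP g).
split=> // [i j neq_ij | i | z].
- by apply: disjoint_unit_carrier_lcosets; rewrite (inj_eq xC_inj).
- exact: card_unit_carrier_lcoset.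
rewrite -unitfE => z_unit; rewrite -[z]/(val (FinRing.unit F z_unit)).
rewrite count_circular_differences_lcosets count_coset //.
by apply/lcosetsP; exists (FinRing.unit F z_unit).
Qed.

End CosetFamilies.

Section CyclotomicFamily.

Variables (F : finFieldType) (m l : nat) (theta : {unit F}).
Variable sigma : 'Z_m -> 'Z_(m * l).

Lemma subgroupCE : subgroupC m l theta = <[theta ^+ (m * l)]>%G.
Proof. by rewrite /subgroupC /beta -expgM mulnC. Qed.

Lemma card_subgroupC :
  (m * l %| #[theta]%g)%N -> #|subgroupC m l theta| = (#[theta]%g %/ (m * l))%N.
Proof. by move=> ml_dvd; rewrite subgroupCE -orderE orderXdiv. Qed.

Lemma familyD_lcoset_inj :
  (1 < m * l)%N -> (m * l %| #[theta]%g)%N -> injective sigma ->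
  injective (fun j => theta ^+ sigma j *: subgroupC m l theta)%g.
Proof.
move=> ml_gt1 ml_dvd sigma_inj; rewrite subgroupCE => i j /eqP.
have sigma_lt k : (sigma k < m * l)%N by rewrite -[X in (_ < X)%N]Zp_cast.
rewrite lcoset_expg_cycle_expg //.
by rewrite !modn_small ?sigma_lt // => /eqP /val_inj /sigma_inj.
Qed.

Lemma perm_shifted_differences (S : {set 'Z_m}) :
  #|subgroupC m l theta| = l ->
  perm_eq (shifted_differences theta sigma S)
    (circular_coset_differences (subgroupC m l theta) S
       (fun j => theta ^+ sigma j)%g).
Proof.
move=> card_C; apply/seq.permP => a.
rewrite !count_bigcat; apply: eq_bigr => c _.
rewrite !count_bigcat; apply: eq_bigr => j _.
rewrite [RHS](seq.permP (perm_map _ (perm_enum_cycle _))) orderE card_C.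
rewrite -map_comp.
by congr (count a _); apply: eq_map => r /=; rewrite -expgM !FinRing.val_unitX.
Qed.

End CyclotomicFamily.

Theorem theorem4 (p k q m l : nat) (F : finFieldType) (theta : {unit F})
    (sigma : 'Z_m -> 'Z_(m * l)) (S : {set 'Z_m})
    (p_prime : prime p) (k_gt0 : (0 < k)%N) (q_def : q = (p ^ k)%N)
    (F_card : #|F| = q)
    (l_ge2 : (2 <= l)%N) (m_ge2 : (2 <= m)%N)
    (q_ml : (q - 1)%N = (m * l ^ 2)%N)
    (theta_primitive : generator [set: {unit F}] theta)
    (sigma_inj : injective sigma)
    (S_nonempty : S != set0) (S_nonzero : 0 \notin S) :
  is_CEDF q l #|S| S (familyD theta sigma)
  <->
  (forall X : {set {unit F}},
     X \in lcosets (subgroupC m l theta) [set: {unit F}] ->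
     count [in unit_carrier X] (shifted_differences theta sigma S) = #|S|).
Proof.
have ord_theta : #[theta]%g = (m * l * l)%N.
  rewrite -mulnA mulnn -q_ml -F_card subn1 -card_finField_unit.
  by rewrite (eqP theta_primitive).
have ml_gt1 : (1 < m * l)%N.
  exact: leq_trans m_ge2 (leq_pmulr _ (ltnW l_ge2)).
have ml_dvd : (m * l %| #[theta]%g)%N by rewrite ord_theta dvdn_mulr.
have card_C : #|subgroupC m l theta| = l.
  by rewrite card_subgroupC // ord_theta mulKn // ltnW.
have cosets_inj := familyD_lcoset_inj ml_gt1 ml_dvd sigma_inj.
have /seq.permP count_shifted := perm_shifted_differences sigma S card_C.
have := is_CEDF_lcosets #|S| m_ge2 _ S_nonempty S_nonzero cosets_inj.
rewrite F_card card_C => /(_ l_ge2) is_CEDF_iff; apply: (iff_trans is_CEDF_iff).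
by split=> count_coset X /count_coset <-; rewrite count_shifted.
Qed.
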